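(* For every $n \ge 3$ and every integer $i \ge \lfloor n/2 \rfloor$: (i) if $\mathcal{P}_{n-1}^{i-1} = \emptyset$ and $\mathcal{P}_{n-2}^{i-1} \ne \emptyset$, then $\mathcal{P}_n^i = \{X \cup \{n-1\} : X \in \mathcal{P}_{n-2}^{i-1}\}$; (ii) if $\mathcal{P}_{n-1}^{i-1} \ne \emptyset$ and $\mathcal{P}_{n-2}^{i-1} \ne \emptyset$, then $\mathcal{P}_n^i = \{\{n\} \cup X_1 : X_1 \in \mathcal{P}_{n-1}^{i-1}\} \cup \{\{n-1\} \cup X_2 : X_2 \in \mathcal{P}_{n-2}^{i-1}\}$.
   Context: All graphs are finite and simple. For a connected graph $H$, a non-empty set $S \subseteq V(H)$ is a weakly connected dominating set of $H$ if the spanning subgraph of $H$ obtained by removing all edges joining two vertices of $V(H)\setminus S$ is connected. $P_n$ is the path with vertex set $[n]=\{1,\dots,n\}$ and edges $\{k,k+1\}$ for $1\le k\le n-1$. $\mathcal{P}_n^i$ denotes the family of weakly connected dominating sets of $P_n$ of cardinality $i$. *)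

(* Defs.v *)
From HB Require Import structures.
From mathcomp Require Import all_boot finmap.

Set Implicit Arguments.
Unset Strict Implicit.
Unset Printing Implicit Defensive.

Local Open Scope fset_scope.

Record sgraph (K : choiceType) := SGraph {
  vertices : {fset K};
  adj : rel K;
  adj_vertices : forall x y, adj x y -> (x \in vertices) && (y \in vertices);
  adj_sym : symmetric adj;
  adj_irr : irreflexive adj
}.

Section WeaklyConnectedDomination.
Variables (K : choiceType) (H : sgraph K).
Implicit Types S : {fset K}.

Definition connected : bool :=
  (vertices H != fset0) &&
  [forall x : vertices H, forall y : vertices H,
     connect (fun u v : vertices H => adj H (val u) (val v)) x y].

Definition weak_adj S : rel K :=
  fun x y => adj H x y &&
    ~~ ((x \in vertices H `\` S) && (y \in vertices H `\` S)).

Fact weak_adj_vertices S x y :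
  weak_adj S x y -> (x \in vertices H) && (y \in vertices H).
Proof. by case/andP=> /adj_vertices. Qed.

Fact weak_adj_sym S : symmetric (weak_adj S).
Proof. by move=> x y; rewrite /weak_adj adj_sym [X in ~~ X]andbC. Qed.

Fact weak_adj_irr S : irreflexive (weak_adj S).
Proof. by move=> x; rewrite /weak_adj adj_irr. Qed.

Definition weak_subgraph S : sgraph K :=
  SGraph (@weak_adj_vertices S) (@weak_adj_sym S) (@weak_adj_irr S).

End WeaklyConnectedDomination.

(* No connectedness hypothesis on H is needed: weak_subgraph H S spans H, so
   is_wcds H S already forces H to be connected. *)
Definition is_wcds (K : choiceType) (H : sgraph K) (S : {fset K}) : bool :=
  [&& S != fset0, S `<=` vertices H & connected (weak_subgraph H S)].

Definition path_adj (n : nat) : rel nat :=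
  fun x y => [&& 1 <= x <= n, 1 <= y <= n & (y == x.+1) || (x == y.+1)].

Definition path_vertices (n : nat) : {fset nat} := [fset k in iota 1 n].

Fact path_adj_vertices n x y :
  path_adj n x y -> (x \in path_vertices n) && (y \in path_vertices n).
Proof. by case/and3P=> xn yn _; rewrite !inE !mem_iota !add1n !ltnS xn yn. Qed.

Fact path_adj_sym n : symmetric (path_adj n).
Proof. by move=> x y; rewrite /path_adj andbCA orbC. Qed.

Fact path_adj_irr n : irreflexive (path_adj n).
Proof. by move=> x; rewrite /path_adj orbb ltn_eqF ?ltnSn // !andbF. Qed.

Definition path_graph (n : nat) : sgraph nat :=
  SGraph (@path_adj_vertices n) (@path_adj_sym n) (@path_adj_irr n).

Definition path_wcds (n i : nat) : {fset {fset nat}} :=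
  [fset S in fpowerset (vertices (path_graph n)) |
     is_wcds (path_graph n) S && (#|` S| == i)].

(* Main.v *)
(** Deleting any edge disconnects a path, so a nonempty [S] is a weakly connected
    dominating set of [P_n] iff it meets every edge, i.e. is a vertex cover. A cover
    containing [n] restricts to a cover of [P_(n-1)]; one avoiding [n] contains
    [n-1], and the rest is a cover of [P_(n-2)]. *)

Require Import Defs.
From mathcomp Require Import all_boot finmap.
From mathcomp Require Import zify.

Local Open Scope fset_scope.

Lemma path_verticesE n k : (k \in path_vertices n) = (1 <= k <= n).
Proof. by rewrite !inE mem_iota add1n ltnS. Qed.

Lemma weak_path_adjE n (S : {fset nat}) x y :
  weak_adj (path_graph n) S x y =
  path_adj n x y && ((x \in S) || (y \in S)).
Proof.
rewrite /weak_adj !in_fsetD /=; case axy: (path_adj n x y) => //=.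
have /andP[-> ->] := @path_adj_vertices n x y axy.
by rewrite !andbT negb_and !negbK.
Qed.

(** An edge missed by [S] is deleted, which separates the two sides of the path; if no edge is
    missed, the whole path survives. [0 < n] supplies vertex 1, the base point for the converse. *)
Lemma weak_path_connectedP n (S : {fset nat}) : 0 < n ->
  reflect (forall k, 0 < k < n -> (k \in S) || (k.+1 \in S))
    (connected (weak_subgraph (path_graph n) S)).
Proof.
move=> n0; set e := fun u v : path_vertices n => weak_adj (path_graph n) S (val u) (val v).
have e_sym : connect_sym e by apply: sym_connect_sym => u v; apply: weak_adj_sym.
apply: (iffP andP) => [[_ /forallP cS] k /andP[k0 kn]|cover].
- have kP : k \in path_vertices n by rewrite path_verticesE k0 ltnW.
  have k1P : k.+1 \in path_vertices n by rewrite path_verticesE.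
  have /forallP/(_ [` k1P]) {cS} := cS [` kP].
  apply: contraTT; rewrite negb_or => /andP[kS k1S].
  (* The only edge of the path leaving the segment from 1 to [k] joins [k] to [k.+1], and it is
     deleted because [S] misses both ends. *)
  have cl : closed e [pred u : path_vertices n | val u <= k].
    move=> [u uP] [v vP]; rewrite /e weak_path_adjE !inE /=.
    case/andP=> /and3P[_ _ uv] uvS; apply/idP/idP => le_k;
      rewrite leqNgt; apply/negP => lt_k; case/orP: uv => /eqP uv; try lia.
    + have [vE uE] : v = k.+1 /\ u = k by lia.
      by move: uvS; rewrite uE vE (negbTE kS) (negbTE k1S).
    + have [vE uE] : v = k /\ u = k.+1 by lia.
      by move: uvS; rewrite uE vE (negbTE kS) (negbTE k1S).
  apply/negP => /(closed_connect cl).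
  by rewrite !inE /= leqnn ltnn.
- have P1 : 1 \in path_vertices n by rewrite path_verticesE.
  (* Walk up the path from 1: each edge used meets [S], hence survives. *)
  have from1 k (kP : k \in path_vertices n) : connect e [` P1] [` kP].
    elim: k kP => [|k IH] kP; first by have := kP; rewrite path_verticesE.
    have [k0|k0] := posnP k; first by subst k; rewrite (bool_irrelevance kP P1).
    have kn : k < n by have := kP; rewrite path_verticesE.
    have kP' : k \in path_vertices n by rewrite path_verticesE k0 ltnW.
    apply: connect_trans (IH kP') (connect1 _).
    by rewrite /e weak_path_adjE /path_adj /= k0 kn ltnW //= eqxx cover ?k0.
  split; first by apply/fset0Pn; exists 1.
  apply/forallP => -[x xP]; apply/forallP => -[y yP].
  by apply: connect_trans (from1 y yP); rewrite -/e e_sym.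
Qed.

(** This removes connectivity from the argument: the recurrence below works only with this
    vertex-cover description. *)
Lemma path_wcdsP n i (S : {fset nat}) :
  reflect [/\ S != fset0, forall k : nat, k \in S -> 0 < k <= n,
              forall k, 0 < k < n -> (k \in S) || (k.+1 \in S) & #|` S| = i]
    (S \in path_wcds n i).
Proof.
have vP : reflect (forall k : nat, k \in S -> 0 < k <= n) (S `<=` path_vertices n).
  by apply: (iffP (@fsubsetP _ S (path_vertices n))) => sS k; have := sS k; rewrite path_verticesE.
have n_gt0 : S != fset0 -> (forall k : nat, k \in S -> 0 < k <= n) -> 0 < n.
  by case/fset0Pn=> k kS /(_ k kS); lia.
rewrite /path_wcds !inE /= fpowersetE /is_wcds /=.
apply: (iffP idP).
  case/and3P=> _ /and3P[S0 /vP sS cS] /eqP Si; split=> //.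
  exact/(weak_path_connectedP _ _ (n_gt0 S0 sS)).
case=> S0 sS cover /eqP->; rewrite S0 (introT vP sS) /= andbT.
exact/(weak_path_connectedP _ _ (n_gt0 S0 sS)).
Qed.

(** The indices are shifted to avoid truncated subtraction. [0 < i] keeps the set nonempty after one
    element is deleted. *)
Lemma path_wcds_rec n i : 0 < n -> 0 < i ->
  path_wcds n.+2 i.+1 =
    [fset [fset n.+2] `|` X | X in path_wcds n.+1 i] `|`
    [fset [fset n.+1] `|` X | X in path_wcds n i].
Proof.
move=> n0 i0; apply/fsetP => S; apply/idP/idP.
- case/path_wcdsP=> _ sS cover Si; rewrite in_fsetU.
  have nz (X : {fset nat}) : #|` X| = i -> X != fset0.
    by move=> Xi; rewrite -cardfs_gt0 Xi.
  have cardD1 x : x \in S -> #|` S `\ x| = i.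
    by move=> xS; have := cardfsD1 x S; rewrite xS Si add1n => -[].
  have [nS|nS] := boolP (n.+2 \in S).
    apply/orP; left; apply/imfsetP; exists (S `\ n.+2); last by rewrite /= fsetD1K.
    (* No edge of the shorter path contains [n.+2], so deleting it uncovers none. *)
    apply/path_wcdsP; split=> [|k|k kn|]; [exact/nz/cardD1| |
      by rewrite !in_fsetD1 !(ltn_eqF (_ : _ < n.+2)) ?cover; lia|exact: cardD1].
    by rewrite in_fsetD1 => /andP[kn /sS]; lia.
  have n1S : n.+1 \in S by have := cover n.+1; rewrite (negbTE nS) orbF; apply; lia.
  apply/orP; right; apply/imfsetP; exists (S `\ n.+1); last by rewrite /= fsetD1K.
  apply/path_wcdsP; split=> [|k|k kn|]; [exact/nz/cardD1| |
    by rewrite !in_fsetD1 !(ltn_eqF (_ : _ < n.+1)) ?cover; lia|exact: cardD1].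
  rewrite in_fsetD1 => /andP[kn1 kS]; have := sS k kS.
  (* With both [n.+1] and [n.+2] excluded, the remaining elements are at most [n]. *)
  have : k != n.+2 by apply: contraNneq nS => <-.
  lia.
- have nz x (X : {fset nat}) : [fset x] `|` X != fset0.
    by apply/fset0Pn; exists x; rewrite !inE eqxx.
  case/fsetUP=> /imfsetP[X /= /path_wcdsP[_ sX cover Xi] ->];
    apply/path_wcdsP; split=> // [k|k kn|].
  + by rewrite !inE => /orP[/eqP->|/sX]; lia.
  (* The only new edge is the last one, which contains [n.+2]. *)
  + rewrite !in_fset1U; have [->|k_neq] := eqVneq k n.+1; first by rewrite eqxx orbT.
    have : (k \in X) || (k.+1 \in X) by apply: cover; lia.
    by case/orP=> ->; rewrite !orbT.
  (* The added vertex exceeds every element of [X], so the cardinality grows by exactly one. *)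
  + by rewrite cardfsU1 Xi; case: (boolP (n.+2 \in X)) => // /sX; lia.
  + by rewrite !inE => /orP[/eqP->|/sX]; lia.
  (* Two edges are new here, and [n.+1] is their common endpoint. *)
  + rewrite !in_fset1U eqSS; have [->|k_neq] := eqVneq k n; first by rewrite orbT.
    have [//|k_neq1] := eqVneq k n.+1.
    have : (k \in X) || (k.+1 \in X) by apply: cover; lia.
    by case/orP=> ->; rewrite !orbT.
  + by rewrite cardfsU1 Xi; case: (boolP (n.+1 \in X)) => // /sX; lia.
Qed.

Theorem theorem3p6 (n i : nat) (hn : 3 <= n) (hi : n %/ 2 <= i) :
  (path_wcds (n - 1) (i - 1) = fset0 ->
   path_wcds (n - 2) (i - 1) <> fset0 ->
   path_wcds n i = [fset X `|` [fset n - 1] | X in path_wcds (n - 2) (i - 1)])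
  /\
  (path_wcds (n - 1) (i - 1) <> fset0 ->
   path_wcds (n - 2) (i - 1) <> fset0 ->
   path_wcds n i =
     [fset [fset n] `|` X1 | X1 in path_wcds (n - 1) (i - 1)] `|`
     [fset [fset n - 1] `|` X2 | X2 in path_wcds (n - 2) (i - 1)]).
Proof.
have rec : path_wcds (n - 2) (i - 1) <> fset0 -> path_wcds n i =
    [fset [fset n] `|` X1 | X1 in path_wcds (n - 1) (i - 1)] `|`
    [fset [fset n - 1] `|` X2 | X2 in path_wcds (n - 2) (i - 1)].
  move/eqP/fset0Pn=> [S /path_wcdsP[S0 _ _ Si]].
  (* A member of the family for [n - 2] is nonempty, so [i] is at least 2 and the subtractions below
     are exact. *)
  have i_gt0 : 0 < i - 1 by rewrite -Si cardfs_gt0.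
  have := @path_wcds_rec (n - 2) (i - 1).
  have -> : (n - 2).+2 = n by lia.
  have -> : (n - 2).+1 = n - 1 by lia.
  have -> : (i - 1).+1 = i by lia.
  by apply; lia.
split=> [none /rec ->|_ /rec //].
(* In case (i) the family built from [n - 1] is the image of the empty set, so only the other one
   remains, up to the order of the union. *)
rewrite none; apply/fsetP => S; rewrite in_fsetU.
have -> : (S \in [fset [fset n] `|` X1 | X1 in fset0]) = false.
  by apply/negP => /imfsetP[].
by apply: (congr1 (fun A : {fset {fset nat}} => S \in A)); apply: eq_imfset => // X;
  rewrite fsetUC.
Qed.
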